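(* Fix $k\geq 1$. For all integers $n\ge k-1$, $$W_{n+2,k}(x)=\frac{(n+2)\left(2(n-k+1)-(n-2k+1)x\right)}{(n-k+2)(n-k+3)}W_{n+1,k}(x)+\frac{(n+1)(n+2)(n-k)(x-1)}{(n-k+2)^2(n-k+3)}W_{n,k}(x),$$ where $W_{n,k}(x)=\sum_{m=0}^{k}w_{n,k,m}x^m$.
   Context: For integers $n,k,m$ (with $k\ge1$) define $w_{n,k,m}=\frac{1}{k}\binom{n}{k-1}\binom{n-k-1}{m-1}\binom{k}{m}$ if $0<m\le k$ and $k+m\le n$; $w_{n,k,m}=1$ if $m=0$ and $n=k$; and $w_{n,k,m}=0$ otherwise. (Combinatorially, $w_{n,k,m}$ is the number of Dyck paths of semilength $n$ with $k$ occurrences of $UD$ and $m$ occurrences of $UUD$.) *)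

(* Defs.v *)
From mathcomp Require Export all_boot all_order all_algebra.
Set Implicit Arguments.
Unset Strict Implicit.
Unset Printing Implicit Defensive.
Import GRing.Theory.
Local Open Scope ring_scope.

(* The guard [k + m <= n] with [0 < m] makes the truncated subtractions exact. *)
Definition w (n k m : nat) : rat :=
  if [&& 0 < m, m <= k & k + m <= n]%N then
    k%:R^-1 * 'C(n, k - 1)%:R * 'C(n - k - 1, m - 1)%:R * 'C(k, m)%:R
  else if (m == 0)%N && (n == k) then 1 else 0.

Definition W (n k : nat) : {poly rat} := \sum_(0 <= m < k.+1) w n k m *: 'X^m.

(* Main.v *)
Require Import Defs.
From mathcomp Require Import all_boot all_order all_algebra.
From mathcomp Require Import ring zify.
Import GRing.Theory Num.Theory.
Local Open Scope ring_scope.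

(** For [n = k + d + 1] the polynomial [W n k] is ['C(n, k - 1) / k] times
    [Q_d = \sum_j 'C(d, j) 'C(k, j + 1) X^(j+1)], and the claim reduces to
    [(d+2) Q_(d+1) = (2(d+1) - (d+1-k) X) Q_d + d (X - 1) Q_(d-1)].
    In degree [j + 1], the Pascal and absorption identities turn the
    coefficients of ['C(k, j+1)] and ['C(k, j)] into [(j+1) 'C(d, j-1)] and
    [(k-j) 'C(d, j-1)], so it is the identity
    [(j+1) 'C(k, j+1) = (k-j) 'C(k, j)].  The prefactors are absorbed by
    [(n+1-k) 'C(n+1, k) = (n+1) 'C(n, k)]. *)

Lemma coef_W n k m : (W n k)`_m = w n k m.
Proof.
rewrite /W big_mkord -(poly_def k.+1 (w n k)) coef_poly ltnS.
case: leqP => // lt_km; rewrite /w.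
by case: m lt_km => // m lt_km; rewrite (leqNgt m.+1) lt_km.
Qed.

(** The coefficient of [X^m] in [Q_d]; the match keeps degree 0 at zero, where a truncated [m - 1]
    would give 1. *)
Definition qcoef (k d m : nat) : rat :=
  if m is j.+1 then 'C(d, j)%:R * 'C(k, j.+1)%:R else 0.

(** Where the guard of [w] fails for positive [m], one of the binomials in [qcoef] vanishes. *)
Lemma w_qcoef k d m :
  w (k + d.+1) k m = k%:R^-1 * 'C(k + d.+1, k - 1)%:R * qcoef k d m.
Proof.
rewrite /w; case: m => [|j] /=; first by rewrite mulr0 ifN // neq_ltn; lia.
have -> : (k + d.+1 - k - 1 = d)%N by lia.
rewrite (subn1 j.+1) /= leq_add2l (ltnS j d).
have [lt_jk|le_kj] := ltnP j k; last by rewrite (@bin_small k) // !mulr0.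
by have [|lt_dj] := leqP j d; rewrite /= ?mulrA // (@bin_small d) // mulr0 mul0r.
Qed.

Lemma natr_bin_absorb (n j : nat) :
  j.+1%:R * 'C(n, j.+1)%:R = (n%:R - j%:R) * 'C(n, j)%:R :> rat.
Proof.
have [le_jn|lt_nj] := leqP j n; last by rewrite !bin_small ?mulr0 // ltnW.
by rewrite -natrB // -!natrM mul_bin_left.
Qed.

Lemma natr_bin_up (n j : nat) :
  (n%:R + 1 - j%:R) * 'C(n.+1, j)%:R = (n%:R + 1) * 'C(n, j)%:R :> rat.
Proof.
have [le_jn|lt_nj] := leqP j n.+1; last by rewrite !bin_small ?mulr0 // ltnW.
by rewrite natr1 -natrB // -!natrM -mul_bin_down.
Qed.

Lemma qcoef_rec k d j :
  (d%:R + 2) * qcoef k d.+1 j.+1 =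
    2 * (d%:R + 1) * qcoef k d j.+1 - (d%:R + 1 - k%:R) * qcoef k d j
    + d%:R * (qcoef k d.-1 j - qcoef k d.-1 j.+1).
Proof.
(* At [d = 0] the truncated [d.-1] is harmless, since both sides are 0. *)
have down i : d%:R * 'C(d.-1, i)%:R = (d%:R - i%:R) * 'C(d, i)%:R :> rat.
  case: d => [|d]; last by rewrite /= -natr1 -natr_bin_up.
  by case: i => [|i]; rewrite ?bin0n ?subrr ?mul0r ?mulr0.
case: j => [|j] /=.
  by rewrite !bin0; ring.
have Ed := natr_bin_absorb d j; have Ek := natr_bin_absorb k j.+1.
rewrite mulrBr !mulrA !down binS natrD -!natr1 in Ed Ek *.
move: Ed Ek.
move: ('C(d, j)%:R : rat) ('C(d, j.+1)%:R : rat) => a b.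
move: ('C(k, j.+1)%:R : rat) ('C(k, j.+2)%:R : rat) => c e Ed Ek.
apply/eqP; rewrite -subr_eq0; apply/eqP.
(* The difference of the two sides is [a] times the defect of [Ek] minus [e] times that of [Ed]. *)
transitivity (a * ((j%:R + 1 + 1) * e - (k%:R - (j%:R + 1)) * c)
   - e * ((j%:R + 1) * b - (d%:R - j%:R) * a)); first by ring.
by rewrite Ed Ek; ring.
Qed.

Theorem theorem2p3 (k : nat) (hk : (1 <= k)%N) (n : nat) (hn : (k - 1 <= n)%N) :
  W (n + 2) k =
    ((n%:R + 2) / ((n%:R - k%:R + 2) * (n%:R - k%:R + 3))) *:
      ((2 * (n%:R - k%:R + 1))%:P - (n%:R - 2 * k%:R + 1) *: 'X) * W (n + 1) k
    + ((n%:R + 1) * (n%:R + 2) * (n%:R - k%:R)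
        / ((n%:R - k%:R + 2) ^+ 2 * (n%:R - k%:R + 3))) *:
      ('X - 1) * W n k.
Proof.
apply/polyP => m.
rewrite -!scalerAl !mulrBl mul1r -!scalerAl coefD !coefZ !coefB coefCM.
rewrite !coefZ !coefXM !coef_W.
have [lt_nk|le_kn] := ltnP n k.
  (* Boundary case [n = k - 1]: here [W n k] is 0 and [W (n + 1) k] is 1, so the claim is that
     [W (n + 2) k] is ['C(k + 1, 2)] times [X]. *)
  case: k hk hn lt_nk => // k _; rewrite subn1 /= => le_kn lt_nk.
  have {le_kn lt_nk} -> : n = k by lia.
  have w0 i : w k k.+1 i = 0.
    by rewrite /w !ifN //; apply/negP; lia.
  have w1 i : w (k + 1) k.+1 i = (i == 0%N)%:R.
    by rewrite addn1 /w eqxx andbT ifN; [case: eqP | apply/negP; lia].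
  have -> : (k + 2 = k.+1 + 1)%N by lia.
  rewrite !w0 !w1 w_qcoef.
  have kS0 : k%:R + 1 != 0 :> rat by rewrite natr1 pnatr_eq0.
  have Dk : k%:R - k.+1%:R = -1 :> rat by rewrite -natr1; ring.
  have -> : 'C(k.+1 + 1, k.+1 - 1)%:R = (k%:R + 2) * (k%:R + 1) / 2 :> rat.
    have -> : (k.+1 + 1 = k.+2)%N by lia.
    rewrite subn1 /= -bin_sub; last by lia.
    have -> : (k.+2 - k = 2)%N by lia.
    have := natr_bin_absorb k.+2 1; rewrite bin1 => E.
    have -> : 'C(k.+2, 2)%:R = (2 * 'C(k.+2, 2)%:R) / 2 :> rat by field.
    by rewrite E -[k.+2%:R]natr1 -[k.+1%:R]natr1; field.
  rewrite !Dk -[k.+1%:R]natr1.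
  case: m => [|[|m]] /=; rewrite ?bin0 ?bin1 ?bin0n /= -?[k.+1%:R]natr1; by field.
have [d {hn le_kn} ->] : exists d, n = (k + d)%N by exists (n - k)%N; lia.
have -> : (k + d + 2 = k + d.+2)%N by lia.
have -> : (k + d + 1 = k + d.+1)%N by lia.
set c := k%:R^-1 * 'C(k + d, k - 1)%:R : rat.
have dn j : d%:R + j.+1%:R != 0 :> rat by rewrite -natrD pnatr_eq0 addnS.
have [d2 d3] : d%:R + 2 != 0 :> rat /\ d%:R + 3 != 0 :> rat by split; apply: dn.
(* Of the denominators in the claim, [d + 3] comes from [Ck2] and one [d + 2] from [qcoef_rec]; the
   second [d + 2] in the last term comes from [Ck1]. *)
have Ck1 : 'C(k + d.+1, k - 1)%:R
    = (k%:R + d%:R + 1) / (d%:R + 2) * 'C(k + d, k - 1)%:R :> rat.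
  have := natr_bin_up (k + d) (k - 1); rewrite natrB // natrD addnS => E.
  apply: (mulfI d2); transitivity ((k%:R + d%:R + 1) * 'C(k + d, k - 1)%:R : rat).
    by rewrite -E; ring.
  by field.
have Ck2 : 'C(k + d.+2, k - 1)%:R
    = (k%:R + d%:R + 2) / (d%:R + 3) * 'C(k + d.+1, k - 1)%:R :> rat.
  have := natr_bin_up (k + d.+1) (k - 1); rewrite natrB // natrD !addnS -natr1 => E.
  apply: (mulfI d3); transitivity ((k%:R + d%:R + 2) * 'C((k + d).+1, k - 1)%:R : rat).
    have -> : k%:R + d%:R + 2 = k%:R + (d%:R + 1) + 1 :> rat by ring.
    by rewrite -E; ring.
  by field.
(* At [d = 0], [W k k = 1] is not of the form above, but its factor [d] vanishes. *)
have wd i : d%:R * w (k + d) k i = d%:R * (c * qcoef k d.-1 i).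
  by rewrite /c; case: (d) => [|e]; rewrite ?mul0r ?w_qcoef.
have k0 : k%:R != 0 :> rat by rewrite pnatr_eq0 -lt0n.
(* The last coefficient of the claim without its factor [n - k = d], which stays beside
   [w (k + d) k _] so that [wd] applies. *)
pose B : rat := (k%:R + d%:R + 1) * (k%:R + d%:R + 2)
                / ((d%:R + 2) ^+ 2 * (d%:R + 3)).
have Dk : k%:R + d%:R - k%:R = d%:R :> rat by ring.
rewrite natrD !Dk; case: m => [|j] /=.
  have := wd 0%N; rewrite !w_qcoef /= !mulr0 => wd0.
  transitivity (- (B * (d%:R * w (k + d) k 0))); first by rewrite wd0 mulr0 oppr0.
  by rewrite /B; field; rewrite d2 d3.
transitivity
  ((k%:R + d%:R + 2) / ((d%:R + 2) * (d%:R + 3))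
   * (2 * (d%:R + 1) * w (k + d.+1) k j.+1
      - (d%:R - k%:R + 1) * w (k + d.+1) k j)
   + B * (d%:R * w (k + d) k j - d%:R * w (k + d) k j.+1)); last first.
  by rewrite /B; field; rewrite d2 d3.
rewrite !wd !w_qcoef Ck2 Ck1.
(* Creates the left side of [qcoef_rec]. *)
have -> : qcoef k d.+1 j.+1 = ((d%:R + 2) * qcoef k d.+1 j.+1) / (d%:R + 2).
  by rewrite mulrAC divff // mul1r.
by rewrite qcoef_rec /c /B; field; rewrite k0 d2 d3.
Qed.
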